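(* Let $\mathcal C$ be a monoidal category with unit $I$ such that for any two objects $X$ and $A$ the maps $x.1\colon I.A\to X.A$, where $x$ ranges over all morphisms $x\colon I\to X$, are jointly epimorphic. Let $G$ be a monoidal comonad on $\mathcal C$. Then there is a bijection between (1) braidings on $G$; (2) braidings (in the usual sense) on the monoidal category $\mathcal C^G$ of $G$-coalgebras; and (3) braidings on the cowarped skew monoidal category $\mathcal C[G]$.
   Context: The tensor product of the monoidal category $\mathcal C$ is written $X.Y$ and treated as strict (associativity and unit isomorphisms suppressed). A monoidal comonad $G=(G,\delta,\epsilon,G_2,G_0)$ is a comonad whose functor is lax monoidal, via $G_2\colon GX.GY\to G(X.Y)$ and $G_0\colon I\to GI$, with $\delta$ and $\epsilon$ monoidal natural transformations. The category $\mathcal C^G$ of $G$-coalgebras carries the lifted monoidal structure $(A,\alpha).(B,\beta)=(A.B,\,G_2\circ(\alpha.\beta))$ with unit $(I,G_0)$. Put $v_{X,Y}=G_2\circ(1.\delta_Y)\colon GX.GY\to G(X.GY)$. A braiding on $G$ is a natural isomorphism $y_{X,Y}\colon GX.GY\to GY.GX$ such that for all $X,Y,Z$: (i) $(y_{Y,Z}.1)(1.y_{X,Z})(y_{X,Y}.1)=(1.y_{X,Y})(y_{X,Z}.1)(1.y_{Y,Z})$; (ii) $y_{X,Y.GZ}\,(1.v_{Y,Z})=(v_{Y,Z}.1)(1.y_{X,Z})(y_{X,Y}.1)$; (iii) $y_{X.GY,Z}\,(v_{X,Y}.1)=(1.v_{X,Y})(y_{X,Z}.1)(1.y_{Y,Z})$;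 (iv) $G(1_X.y_{Y,Z})\,v_{X.GY,Z}\,(v_{X,Y}.1)=v_{X.GZ,Y}\,(v_{X,Z}.1)(1.y_{Y,Z})$. A skew monoidal category is a category with a functor $(X,Y)\mapsto XY$, an object $I$ and natural transformations (not necessarily invertible) $a_{X,Y,Z}\colon (XY)Z\to X(YZ)$, $\ell_X\colon IX\to X$, $r_X\colon X\to XI$ such that $a_{A,B,CD}\,a_{AB,C,D}=(1_A a_{B,C,D})\,a_{A,BC,D}\,(a_{A,B,C}1_D)$; $\ell_{AB}\,a_{I,A,B}=\ell_A1_B$; $(1_A\ell_B)\,a_{A,I,B}\,(r_A1_B)=1_{AB}$; $a_{A,B,I}\,r_{AB}=1_Ar_B$; $\ell_I r_I=1_I$. The skew monoidal category $\mathcal C[G]$ has underlying category $\mathcal C$, product $X*Y=X.GY$, unit $I$, associativity $1_X.v_{Y,Z}\colon X.GY.GZ\to X.G(Y.GZ)$, left unit map $\epsilon_X\colon GX\to X$ and right unit map $1_X.G_0\colon X\to X.GI$. A braiding on a skew monoidal category is a natural isomorphism $s_{X,A,B}\colon (XA)B\to (XB)A$ such that for all objects: (B1) $s_{XC,A,B}(s_{X,A,C}1_B)s_{XA,B,C}=(s_{X,B,C}1_A)s_{XB,A,C}(s_{X,A,B}1_C)$; (B2) $s_{X,A,BC}\,a_{XA,B,C}=(a_{X,B,C}1_A)s_{XB,A,C}(s_{X,A,B}1_C)$; (B3) $s_{X,AB,C}(a_{X,A,B}1_C)=a_{XC,A,B}(s_{X,A,C}1_B)s_{XA,B,C}$;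 (B4) $(1_Xs_{A,B,C})\,a_{X,AB,C}(a_{X,A,B}1_C)=a_{X,AC,B}(a_{X,A,C}1_B)s_{XA,B,C}$. *)

(* Defs.v *)
From Stdlib Require Import ssreflect ssrfun ProofIrrelevance.

Set Implicit Arguments.
Unset Strict Implicit.
Unset Printing Implicit Defensive.

Declare Scope cat_scope.
Delimit Scope cat_scope with cat.
Local Open Scope cat_scope.

(* Equality of morphisms is Leibniz equality throughout. *)

Record Category := {
  ob :> Type;
  hom : ob -> ob -> Type;
  idm : forall X, hom X X;
  comp : forall X Y Z, hom Y Z -> hom X Y -> hom X Z;
  comp1m : forall X Y (f : hom X Y), comp (idm Y) f = f;
  compm1 : forall X Y (f : hom X Y), comp f (idm X) = f;
  compA : forall X Y Z W (h : hom Z W) (g : hom Y Z) (f : hom X Y),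
    comp (comp h g) f = comp h (comp g f)
}.

Arguments idm {c} X.

Notation "g ∘ f" := (comp g f) (at level 39, right associativity) : cat_scope.

Definition is_iso (C : Category) (X Y : C) (f : hom X Y) : Prop :=
  exists g : hom Y X, g ∘ f = idm X /\ f ∘ g = idm Y.

Definition jointly_epi (C : Category) (I : Type) (X : I -> C) (Y : C)
    (f : forall i, hom (X i) Y) : Prop :=
  forall (Z : C) (g h : hom Y Z), (forall i, g ∘ f i = h ∘ f i) -> g = h.

Record Functor (C D : Category) := {
  fob :> C -> D;
  fmap : forall X Y, hom X Y -> hom (fob X) (fob Y);
  fmap1 : forall X, fmap (idm X) = idm (fob X);
  fmapM : forall X Y Z (g : hom Y Z) (f : hom X Y),
    fmap (g ∘ f) = fmap g ∘ fmap f
}.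

Arguments fmap {C D} _ {X Y} f.

Record Bifunctor (C : Category) := {
  bob :> C -> C -> C;
  bmap : forall X X' Y Y', hom X X' -> hom Y Y' -> hom (bob X Y) (bob X' Y');
  bmap1 : forall X Y, bmap (idm X) (idm Y) = idm (bob X Y);
  bmapM : forall X X' X'' Y Y' Y''
      (g : hom X' X'') (f : hom X X') (k : hom Y' Y'') (h : hom Y Y'),
    bmap (g ∘ f) (k ∘ h) = bmap g k ∘ bmap f h
}.

Arguments bmap {C} _ {X X' Y Y'} f g.

(* The coherence isomorphisms are kept explicit: no strictness is assumed. *)
Record MonoidalCategory := {
  mcat :> Category;
  tensor : Bifunctor mcat;
  munit : mcat;
  assoc : forall X Y Z, hom (tensor (tensor X Y) Z) (tensor X (tensor Y Z));
  assoc_inv : forall X Y Z, hom (tensor X (tensor Y Z)) (tensor (tensor X Y) Z);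
  lunit : forall X, hom (tensor munit X) X;
  lunit_inv : forall X, hom X (tensor munit X);
  runit : forall X, hom (tensor X munit) X;
  runit_inv : forall X, hom X (tensor X munit);
  assoc_nat : forall X X' Y Y' Z Z'
      (f : hom X X') (g : hom Y Y') (h : hom Z Z'),
    assoc X' Y' Z' ∘ bmap tensor (bmap tensor f g) h
      = bmap tensor f (bmap tensor g h) ∘ assoc X Y Z;
  lunit_nat : forall X X' (f : hom X X'),
    lunit X' ∘ bmap tensor (idm munit) f = f ∘ lunit X;
  runit_nat : forall X X' (f : hom X X'),
    runit X' ∘ bmap tensor f (idm munit) = f ∘ runit X;
  assocK : forall X Y Z, assoc_inv X Y Z ∘ assoc X Y Z = idm _;
  assocVK : forall X Y Z, assoc X Y Z ∘ assoc_inv X Y Z = idm _;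
  lunitK : forall X, lunit_inv X ∘ lunit X = idm _;
  lunitVK : forall X, lunit X ∘ lunit_inv X = idm _;
  runitK : forall X, runit_inv X ∘ runit X = idm _;
  runitVK : forall X, runit X ∘ runit_inv X = idm _;
  pentagon : forall X Y Z W,
    assoc X Y (tensor Z W) ∘ assoc (tensor X Y) Z W
      = bmap tensor (idm X) (assoc Y Z W) ∘ assoc X (tensor Y Z) W
        ∘ bmap tensor (assoc X Y Z) (idm W);
  triangle : forall X Y,
    bmap tensor (idm X) (lunit Y) ∘ assoc X munit Y
      = bmap tensor (runit X) (idm Y)
}.

Arguments assoc {m} X Y Z.
Arguments assoc_inv {m} X Y Z.
Arguments lunit {m} X.
Arguments lunit_inv {m} X.
Arguments runit {m} X.
Arguments runit_inv {m} X.

Notation "X ⊙ Y" := (bob (tensor _) X Y)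
  (at level 36, left associativity) : cat_scope.
Notation "f ⊗ g" := (bmap (tensor _) f g)
  (at level 36, left associativity) : cat_scope.

(* Braidings in the sense of Joyal and Street. *)
Record Braiding (C : MonoidalCategory) := {
  braid : forall A B : C, hom (A ⊙ B) (B ⊙ A);
  braid_nat : forall (A A' B B' : C) (f : hom A A') (g : hom B B'),
    braid A' B' ∘ (f ⊗ g) = (g ⊗ f) ∘ braid A B;
  braid_iso : forall A B, is_iso (braid A B);
  braid_hexagon1 : forall A B D : C,
    assoc B D A ∘ braid A (B ⊙ D) ∘ assoc A B D
      = (idm B ⊗ braid A D) ∘ assoc B A D ∘ (braid A B ⊗ idm D);
  braid_hexagon2 : forall A B D : C,
    assoc_inv D A B ∘ braid (A ⊙ B) D ∘ assoc_inv A B D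
      = (braid A D ⊗ idm B) ∘ assoc_inv A D B ∘ (idm A ⊗ braid B D)
}.

Record Comonad (C : Category) := {
  cofun :> Functor C C;
  comul : forall X, hom (cofun X) (cofun (cofun X));
  counit : forall X, hom (cofun X) X;
  comul_nat : forall X Y (f : hom X Y),
    comul Y ∘ fmap cofun f = fmap cofun (fmap cofun f) ∘ comul X;
  counit_nat : forall X Y (f : hom X Y),
    counit Y ∘ fmap cofun f = f ∘ counit X;
  comulA : forall X,
    comul (cofun X) ∘ comul X = fmap cofun (comul X) ∘ comul X;
  counit_comul : forall X, counit (cofun X) ∘ comul X = idm _;
  fmap_counit_comul : forall X, fmap cofun (counit X) ∘ comul X = idm _
}.

Arguments comul {C} _ X.
Arguments counit {C} _ X.

Record MonoidalComonad (C : MonoidalCategory) := {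
  mcomonad :> Comonad C;
  G2 : forall X Y : C, hom (mcomonad X ⊙ mcomonad Y) (mcomonad (X ⊙ Y));
  G0 : hom (munit C) (mcomonad (munit C));
  G2_nat : forall (X X' Y Y' : C) (f : hom X X') (g : hom Y Y'),
    G2 X' Y' ∘ (fmap mcomonad f ⊗ fmap mcomonad g)
      = fmap mcomonad (f ⊗ g) ∘ G2 X Y;
  G2_assoc : forall X Y Z : C,
    fmap mcomonad (assoc X Y Z) ∘ G2 (X ⊙ Y) Z ∘ (G2 X Y ⊗ idm _)
      = G2 X (Y ⊙ Z) ∘ (idm _ ⊗ G2 Y Z)
        ∘ assoc (mcomonad X) (mcomonad Y) (mcomonad Z);
  G2_lunit : forall X : C,
    fmap mcomonad (lunit X) ∘ G2 (munit C) X ∘ (G0 ⊗ idm _)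
      = lunit (mcomonad X);
  G2_runit : forall X : C,
    fmap mcomonad (runit X) ∘ G2 X (munit C) ∘ (idm _ ⊗ G0)
      = runit (mcomonad X);
  comul_G2 : forall X Y : C,
    comul mcomonad (X ⊙ Y) ∘ G2 X Y
      = fmap mcomonad (G2 X Y) ∘ G2 (mcomonad X) (mcomonad Y)
        ∘ (comul mcomonad X ⊗ comul mcomonad Y);
  comul_G0 : comul mcomonad (munit C) ∘ G0 = fmap mcomonad G0 ∘ G0;
  counit_G2 : forall X Y : C,
    counit mcomonad (X ⊙ Y) ∘ G2 X Y = counit mcomonad X ⊗ counit mcomonad Y;
  counit_G0 : counit mcomonad (munit C) ∘ G0 = idm _
}.

Arguments G2 {C} _ X Y.
Arguments G0 {C} _.

Section CategoryLemmas.

Variable C : Category.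

Lemma comp_pre (X Y Y' Z : C) (g : hom Y Z) (f : hom X Y)
    (g' : hom Y' Z) (f' : hom X Y') :
  g ∘ f = g' ∘ f' -> forall W (z : hom W X), g ∘ f ∘ z = g' ∘ f' ∘ z.
Proof. by move=> e W z; rewrite -!compA e. Qed.

Lemma comp_pre1 (X Y Z : C) (g : hom Y Z) (f : hom X Y) (k : hom X Z) :
  g ∘ f = k -> forall W (z : hom W X), g ∘ f ∘ z = k ∘ z.
Proof. by move=> e W z; rewrite -!compA e. Qed.

Lemma comp_pre3 (X Y Y' Z : C) (h : hom Y' Z) (g : hom Y Y') (f : hom X Y)
    (k : hom X Z) :
  h ∘ g ∘ f = k -> forall W (z : hom W X), h ∘ g ∘ f ∘ z = k ∘ z.
Proof. by move=> e W z; rewrite -e !compA. Qed.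

Lemma comp_inv_square (X X' Y Y' : C) (f : hom X Y) (fV : hom Y X)
    (f' : hom X' Y') (fV' : hom Y' X') (u : hom X X') (w : hom Y Y') :
  f ∘ fV = idm _ -> fV' ∘ f' = idm _ ->
  f' ∘ u = w ∘ f -> fV' ∘ w = u ∘ fV.
Proof.
move=> fK fK' e.
by rewrite -[LHS]compm1 -fK compA -(comp_pre e) -compA fK' comp1m.
Qed.

End CategoryLemmas.

Section MonoidalLemmas.

Variable C : MonoidalCategory.

Lemma bmap_pre (A A' A'' B B' B'' W : C) (g : hom A' A'') (f : hom A A')
    (k : hom B' B'') (h : hom B B') (z : hom W (A ⊙ B)) :
  (g ⊗ k) ∘ (f ⊗ h) ∘ z = ((g ∘ f) ⊗ (k ∘ h)) ∘ z.
Proof. by rewrite -!compA -bmapM. Qed.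

Lemma lwhiskerM (A X Y Z : C) (g : hom Y Z) (f : hom X Y) :
  idm A ⊗ (g ∘ f) = (idm A ⊗ g) ∘ (idm A ⊗ f).
Proof. by rewrite -bmapM comp1m. Qed.

Lemma rwhiskerM (A X Y Z : C) (g : hom Y Z) (f : hom X Y) :
  (g ∘ f) ⊗ idm A = (g ⊗ idm A) ∘ (f ⊗ idm A).
Proof. by rewrite -bmapM comp1m. Qed.

Lemma bmap_lr (X X' Y Y' : C) (f : hom X X') (g : hom Y Y') :
  f ⊗ g = (f ⊗ idm _) ∘ (idm _ ⊗ g).
Proof. by rewrite -bmapM comp1m compm1. Qed.

Lemma lwhisker_inj (X Y : C) (f g : hom X Y) :
  idm (munit C) ⊗ f = idm (munit C) ⊗ g -> f = g.
Proof.
move=> e; rewrite -[f]compm1 -[g]compm1 -(lunitVK X) -!compA.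
by rewrite -!lunit_nat e.
Qed.

Lemma rwhisker_inj (X Y : C) (f g : hom X Y) :
  f ⊗ idm (munit C) = g ⊗ idm (munit C) -> f = g.
Proof.
move=> e; rewrite -[f]compm1 -[g]compm1 -(runitVK X) -!compA.
by rewrite -!runit_nat e.
Qed.

Lemma assoc_epi (X Y Z W : C) (f g : hom (X ⊙ (Y ⊙ Z)) W) :
  f ∘ assoc X Y Z = g ∘ assoc X Y Z -> f = g.
Proof.
move=> e; rewrite -[f]compm1 -[g]compm1 -(assocVK X Y Z) -!compA.
by rewrite e.
Qed.

Lemma assoc_mono (X Y Z W : C) (f g : hom W (X ⊙ Y ⊙ Z)) :
  assoc X Y Z ∘ f = assoc X Y Z ∘ g -> f = g.
Proof.
move=> e; rewrite -[f]comp1m -[g]comp1m -(assocK X Y Z) !compA.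
by rewrite e.
Qed.

Lemma lunit_assoc (X Y : C) :
  lunit (X ⊙ Y) ∘ assoc (munit C) X Y = lunit X ⊗ idm Y.
Proof.
apply: lwhisker_inj; apply: assoc_epi.
have aK : (assoc (munit C) (munit C) X ⊗ idm Y)
    ∘ (assoc_inv (munit C) (munit C) X ⊗ idm Y) = idm _.
  by rewrite -bmapM assocVK comp1m bmap1.
rewrite -[LHS]compm1 -[RHS]compm1 -aK -!compA; congr (_ ∘ _); rewrite !compA.
rewrite -[RHS](comp_pre (assoc_nat _ _ _)) -bmapM triangle comp1m assoc_nat bmap1.
rewrite lwhiskerM !compA -pentagon.
by rewrite (comp_pre1 (triangle _ _)).
Qed.

Lemma runit_assoc (X Y : C) :
  (idm X ⊗ runit Y) ∘ assoc X Y (munit C) = runit (X ⊙ Y).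
Proof.
apply: rwhisker_inj; apply: assoc_mono.
rewrite rwhiskerM.
rewrite (comp_pre (assoc_nat _ _ _)) -(triangle Y).
rewrite lwhiskerM !compA -pentagon.
by rewrite -(comp_pre (assoc_nat _ _ _)) bmap1 triangle.
Qed.

Lemma lunit_runit : lunit (munit C) = runit (munit C).
Proof.
apply: rwhisker_inj; rewrite -triangle -lunit_assoc; congr (_ ∘ _).
have := lunit_nat (lunit (munit C)).
move=> /(f_equal (fun h => lunit_inv _ ∘ h)).
by rewrite -!compA lunitK !comp1m.
Qed.

End MonoidalLemmas.

(* X.f modulo associativity, as a map between left-bracketed products. *)
Definition mid (C : MonoidalCategory) (X Y Z Y' Z' : C)
    (f : hom (Y ⊙ Z) (Y' ⊙ Z')) : hom (X ⊙ Y ⊙ Z) (X ⊙ Y' ⊙ Z') :=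
  assoc_inv X Y' Z' ∘ (idm X ⊗ f) ∘ assoc X Y Z.

Arguments mid {C} X {Y Z Y' Z'} f.

Section MonoidalComonadTheory.

Variables (C : MonoidalCategory) (G : MonoidalComonad C).

Definition vmap (X Y : C) : hom (G X ⊙ G Y) (G (X ⊙ G Y)) :=
  G2 G X (G Y) ∘ (idm (G X) ⊗ comul G Y).

(* In each axiom, multiple products are bracketed to the left wherever
   v and y do not force another bracketing. *)
Record ComonadBraiding := {
  cbraid : forall X Y : C, hom (G X ⊙ G Y) (G Y ⊙ G X);
  cbraid_nat : forall (X X' Y Y' : C) (f : hom X X') (g : hom Y Y'),
    cbraid X' Y' ∘ (fmap G f ⊗ fmap G g)
      = (fmap G g ⊗ fmap G f) ∘ cbraid X Y;
  cbraid_iso : forall X Y, is_iso (cbraid X Y);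
  cbraid_yang_baxter : forall X Y Z : C,
    (cbraid Y Z ⊗ idm (G X)) ∘ mid (G Y) (cbraid X Z)
        ∘ (cbraid X Y ⊗ idm (G Z))
      = mid (G Z) (cbraid X Y) ∘ (cbraid X Z ⊗ idm (G Y))
        ∘ mid (G X) (cbraid Y Z);
  cbraid_v_right : forall X Y Z : C,
    cbraid X (Y ⊙ G Z) ∘ (idm (G X) ⊗ vmap Y Z)
        ∘ assoc (G X) (G Y) (G Z)
      = (vmap Y Z ⊗ idm (G X)) ∘ mid (G Y) (cbraid X Z)
        ∘ (cbraid X Y ⊗ idm (G Z));
  cbraid_v_left : forall X Y Z : C,
    cbraid (X ⊙ G Y) Z ∘ (vmap X Y ⊗ idm (G Z))
      = (idm (G Z) ⊗ vmap X Y) ∘ assoc (G Z) (G X) (G Y)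
        ∘ (cbraid X Z ⊗ idm (G Y)) ∘ mid (G X) (cbraid Y Z);
  cbraid_v_v : forall X Y Z : C,
    fmap G (mid X (cbraid Y Z)) ∘ vmap (X ⊙ G Y) Z
        ∘ (vmap X Y ⊗ idm (G Z))
      = vmap (X ⊙ G Z) Y ∘ (vmap X Z ⊗ idm (G Y))
        ∘ mid (G X) (cbraid Y Z)
}.

Record Coalgebra := {
  carrier :> C;
  coact : hom carrier (G carrier);
  coact_counit : counit G carrier ∘ coact = idm _;
  coact_comul : comul G carrier ∘ coact = fmap G coact ∘ coact
}.

Record CoalgHom (A B : Coalgebra) := {
  coalg_mor :> hom A B;
  coalg_morP : coact B ∘ coalg_mor = fmap G coalg_mor ∘ coact A
}.

Lemma CoalgHom_ext (A B : Coalgebra) (f g : CoalgHom A B) :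
  coalg_mor f = coalg_mor g -> f = g.
Proof.
case: f g => [f Hf] [g Hg] /= e; subst g.
by rewrite (proof_irrelevance _ Hf Hg).
Qed.

Definition coalg_id (A : Coalgebra) : CoalgHom A A.
Proof. by exists (idm A); rewrite fmap1 comp1m compm1. Defined.

Definition coalg_comp (A B D : Coalgebra)
  (g : CoalgHom B D) (f : CoalgHom A B) : CoalgHom A D.
Proof.
exists (coalg_mor g ∘ coalg_mor f).
by rewrite (comp_pre (coalg_morP g)) coalg_morP fmapM compA.
Defined.

Definition coalg_cat : Category.
Proof.
refine {| ob := Coalgebra; hom := CoalgHom; idm := coalg_id;
          comp := coalg_comp |}.
- by move=> X Y f; apply: CoalgHom_ext; apply: comp1m.
- by move=> X Y f; apply: CoalgHom_ext; apply: compm1.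
- by move=> *; apply: CoalgHom_ext; apply: compA.
Defined.

Definition coalg_tensor_ob (A B : Coalgebra) : Coalgebra.
Proof.
exists (A ⊙ B) (G2 G A B ∘ (coact A ⊗ coact B)).
- by rewrite (comp_pre1 (counit_G2 _ _ _)) -bmapM !coact_counit bmap1.
- rewrite (comp_pre1 (comul_G2 _ _ _)) !compA -bmapM !coact_comul bmapM.
  by rewrite (comp_pre (G2_nat _ _ _)) fmapM !compA.
Defined.

Definition coalg_tensor_mor (A A' B B' : Coalgebra)
  (f : CoalgHom A A') (g : CoalgHom B B') :
  CoalgHom (coalg_tensor_ob A B) (coalg_tensor_ob A' B').
Proof.
exists (coalg_mor f ⊗ coalg_mor g) => /=.
rewrite compA -bmapM !coalg_morP bmapM.
by rewrite (comp_pre (G2_nat _ _ _)).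
Defined.

Definition coalg_tensor : Bifunctor coalg_cat.
Proof.
refine (@Build_Bifunctor coalg_cat coalg_tensor_ob coalg_tensor_mor _ _).
- by move=> X Y; apply: CoalgHom_ext; apply: bmap1.
- by move=> *; apply: CoalgHom_ext; apply: bmapM.
Defined.

Definition coalg_unit : Coalgebra.
Proof. exists (munit C) (G0 G); [exact: counit_G0 | exact: comul_G0]. Defined.

Lemma coalg_inv_morP (A B : Coalgebra) (f : hom A B) (g : hom B A) :
  f ∘ g = idm _ -> g ∘ f = idm _ ->
  coact B ∘ f = fmap G f ∘ coact A -> coact A ∘ g = fmap G g ∘ coact B.
Proof.
move=> fg gf e; symmetry; apply: (comp_inv_square fg _ (esym e)).
by rewrite -fmapM gf fmap1.
Qed.

Lemma coalg_assoc_morP (A B D : Coalgebra) :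
  coact (coalg_tensor_ob A (coalg_tensor_ob B D)) ∘ assoc A B D
    = fmap G (assoc A B D)
      ∘ coact (coalg_tensor_ob (coalg_tensor_ob A B) D).
Proof.
rewrite /= -[X in bmap _ X (comp _ _)]comp1m bmapM !compA -assoc_nat.
rewrite -[X in bmap _ (comp _ _) X]comp1m bmapM.
by rewrite (comp_pre3 (G2_assoc _ _ _ _)) !compA.
Qed.

Lemma coalg_lunit_morP (A : Coalgebra) :
  coact A ∘ lunit A
    = fmap G (lunit A) ∘ coact (coalg_tensor_ob coalg_unit A).
Proof.
rewrite /= -[X in bmap _ X _]compm1 -[X in bmap _ _ X]comp1m bmapM.
by rewrite (comp_pre3 (G2_lunit _ _)) lunit_nat.
Qed.

Lemma coalg_runit_morP (A : Coalgebra) :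
  coact A ∘ runit A
    = fmap G (runit A) ∘ coact (coalg_tensor_ob A coalg_unit).
Proof.
rewrite /= -[X in bmap _ _ X]compm1 -[X in bmap _ X _]comp1m bmapM.
by rewrite (comp_pre3 (G2_runit _ _)) runit_nat.
Qed.

Definition coalg_assoc (A B D : Coalgebra) :
  CoalgHom (coalg_tensor_ob (coalg_tensor_ob A B) D)
           (coalg_tensor_ob A (coalg_tensor_ob B D)).
Proof. by exists (assoc A B D); apply: coalg_assoc_morP. Defined.

Definition coalg_assoc_inv (A B D : Coalgebra) :
  CoalgHom (coalg_tensor_ob A (coalg_tensor_ob B D))
           (coalg_tensor_ob (coalg_tensor_ob A B) D).
Proof.
exists (assoc_inv A B D).
apply: (@coalg_inv_morP (coalg_tensor_ob (coalg_tensor_ob A B) D)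
          (coalg_tensor_ob A (coalg_tensor_ob B D)) (assoc A B D)).
- exact: assocVK.
- exact: assocK.
- exact: coalg_assoc_morP.
Defined.

Definition coalg_lunit (A : Coalgebra) :
  CoalgHom (coalg_tensor_ob coalg_unit A) A.
Proof. by exists (lunit A); apply: coalg_lunit_morP. Defined.

Definition coalg_lunit_inv (A : Coalgebra) :
  CoalgHom A (coalg_tensor_ob coalg_unit A).
Proof.
exists (lunit_inv A).
apply: (@coalg_inv_morP (coalg_tensor_ob coalg_unit A) A (lunit A)).
- exact: lunitVK.
- exact: lunitK.
- exact: coalg_lunit_morP.
Defined.

Definition coalg_runit (A : Coalgebra) :
  CoalgHom (coalg_tensor_ob A coalg_unit) A.
Proof. by exists (runit A); apply: coalg_runit_morP. Defined.

Definition coalg_runit_inv (A : Coalgebra) :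
  CoalgHom A (coalg_tensor_ob A coalg_unit).
Proof.
exists (runit_inv A).
apply: (@coalg_inv_morP (coalg_tensor_ob A coalg_unit) A (runit A)).
- exact: runitVK.
- exact: runitK.
- exact: coalg_runit_morP.
Defined.

Definition coalg_monoidal : MonoidalCategory.
Proof.
refine (@Build_MonoidalCategory coalg_cat coalg_tensor coalg_unit
  coalg_assoc coalg_assoc_inv coalg_lunit coalg_lunit_inv
  coalg_runit coalg_runit_inv _ _ _ _ _ _ _ _ _ _ _);
  move=> *; apply: CoalgHom_ext.
- exact: assoc_nat.
- exact: lunit_nat.
- exact: runit_nat.
- exact: assocK.
- exact: assocVK.
- exact: lunitK.
- exact: lunitVK.
- exact: runitK.
- exact: runitVK.
- exact: pentagon.
- exact: triangle.
Defined.

End MonoidalComonadTheory.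

Record SkewMonoidalCategory := {
  scat :> Category;
  stensor : Bifunctor scat;
  sunit : scat;
  sassoc : forall X Y Z,
    hom (stensor (stensor X Y) Z) (stensor X (stensor Y Z));
  slunit : forall X, hom (stensor sunit X) X;
  srunit : forall X, hom X (stensor X sunit);
  sassoc_nat : forall X X' Y Y' Z Z'
      (f : hom X X') (g : hom Y Y') (h : hom Z Z'),
    sassoc X' Y' Z' ∘ bmap stensor (bmap stensor f g) h
      = bmap stensor f (bmap stensor g h) ∘ sassoc X Y Z;
  slunit_nat : forall X X' (f : hom X X'),
    slunit X' ∘ bmap stensor (idm sunit) f = f ∘ slunit X;
  srunit_nat : forall X X' (f : hom X X'),
    srunit X' ∘ f = bmap stensor f (idm sunit) ∘ srunit X;
  spentagon : forall A B D E,
    sassoc A B (stensor D E) ∘ sassoc (stensor A B) D E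
      = bmap stensor (idm A) (sassoc B D E) ∘ sassoc A (stensor B D) E
        ∘ bmap stensor (sassoc A B D) (idm E);
  slunit_assoc : forall A B,
    slunit (stensor A B) ∘ sassoc sunit A B = bmap stensor (slunit A) (idm B);
  striangle : forall A B,
    bmap stensor (idm A) (slunit B) ∘ sassoc A sunit B
      ∘ bmap stensor (srunit A) (idm B) = idm _;
  srunit_assoc : forall A B,
    sassoc A B sunit ∘ srunit (stensor A B)
      = bmap stensor (idm A) (srunit B);
  slunit_srunit : slunit sunit ∘ srunit sunit = idm _
}.

Arguments sassoc {s} X Y Z.
Arguments slunit {s} X.
Arguments srunit {s} X.

Notation "X ⋆ Y" := (bob (stensor _) X Y)
  (at level 36, left associativity) : cat_scope.
Notation "f ⊛ g" := (bmap (stensor _) f g)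
  (at level 36, left associativity) : cat_scope.

Record SkewBraiding (S : SkewMonoidalCategory) := {
  sbraid : forall X A B : S, hom (X ⋆ A ⋆ B) (X ⋆ B ⋆ A);
  sbraid_nat : forall (X X' A A' B B' : S)
      (f : hom X X') (g : hom A A') (h : hom B B'),
    sbraid X' A' B' ∘ (f ⊛ g ⊛ h) = (f ⊛ h ⊛ g) ∘ sbraid X A B;
  sbraid_iso : forall X A B, is_iso (sbraid X A B);
  sbraid_yang_baxter : forall X A B D : S,
    sbraid (X ⋆ D) A B ∘ (sbraid X A D ⊛ idm B) ∘ sbraid (X ⋆ A) B D
      = (sbraid X B D ⊛ idm A) ∘ sbraid (X ⋆ B) A D ∘ (sbraid X A B ⊛ idm D);
  sbraid_assoc_right : forall X A B D : S,
    sbraid X A (B ⋆ D) ∘ sassoc (X ⋆ A) B D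
      = (sassoc X B D ⊛ idm A) ∘ sbraid (X ⋆ B) A D ∘ (sbraid X A B ⊛ idm D);
  sbraid_assoc_left : forall X A B D : S,
    sbraid X (A ⋆ B) D ∘ (sassoc X A B ⊛ idm D)
      = sassoc (X ⋆ D) A B ∘ (sbraid X A D ⊛ idm B) ∘ sbraid (X ⋆ A) B D;
  sbraid_assoc_assoc : forall X A B D : S,
    (idm X ⊛ sbraid A B D) ∘ sassoc X (A ⋆ B) D ∘ (sassoc X A B ⊛ idm D)
      = sassoc X (A ⋆ D) B ∘ (sassoc X A D ⊛ idm B) ∘ sbraid (X ⋆ A) B D
}.

Section Cowarping.

Variables (C : MonoidalCategory) (G : MonoidalComonad C).

Definition cowarp_tensor : Bifunctor C.
Proof.
refine (@Build_Bifunctor C (fun X Y => X ⊙ G Y)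
          (fun X X' Y Y' f g => f ⊗ fmap G g) _ _).
- by move=> X Y; rewrite fmap1 bmap1.
- by move=> *; rewrite fmapM bmapM.
Defined.

Definition cowarp_assoc (X Y Z : C) :
    hom (X ⊙ G Y ⊙ G Z) (X ⊙ G (Y ⊙ G Z)) :=
  (idm X ⊗ vmap G Y Z) ∘ assoc X (G Y) (G Z).

Definition cowarp_lunit (X : C) : hom (munit C ⊙ G X) X :=
  counit G X ∘ lunit (G X).

Definition cowarp_runit (X : C) : hom X (X ⊙ G (munit C)) :=
  (idm X ⊗ G0 G) ∘ runit_inv X.


(* Skew associativity reduces to this property of v. *)
Lemma vmap_assoc (X Y Z : C) :
  vmap G X (Y ⊙ G Z) ∘ (idm _ ⊗ vmap G Y Z) ∘ assoc (G X) (G Y) (G Z)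
    = fmap G (cowarp_assoc X Y Z) ∘ vmap G (X ⊙ G Y) Z
      ∘ (vmap G X Y ⊗ idm _).
Proof.
transitivity (fmap G (idm X ⊗ G2 G Y (G Z)) ∘ G2 G X (G Y ⊙ G (G Z))
  ∘ (idm _ ⊗ G2 G (G Y) (G (G Z)))
  ∘ (idm _ ⊗ (comul G Y ⊗ (fmap G (comul G Z) ∘ comul G Z)))
  ∘ assoc (G X) (G Y) (G Z)).
- rewrite -(comp_pre (G2_nat _ _ _)) fmap1 /vmap -comulA !compA.
  congr (_ ∘ _); rewrite !bmap_pre !comp1m; congr ((_ ⊗ _) ∘ _).
  by rewrite (comp_pre1 (comul_G2 _ _ _)) !compA -bmapM compm1.
- rewrite -assoc_nat.
  have A3 (A B D W : C) (w : hom W _) :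
      G2 G A (B ⊙ D) ∘ (idm _ ⊗ G2 G B D) ∘ assoc (G A) (G B) (G D) ∘ w
      = fmap G (assoc A B D) ∘ G2 G (A ⊙ B) D ∘ (G2 G A B ⊗ idm _) ∘ w.
    by rewrite (comp_pre3 (G2_assoc _ _ _ _)) !compA.
  have E : cowarp_assoc X Y Z = (idm X ⊗ G2 G Y (G Z))
      ∘ assoc X (G Y) (G (G Z)) ∘ (idm (X ⊙ G Y) ⊗ comul G Z).
    by rewrite -bmap1 assoc_nat bmap_pre comp1m.
  rewrite A3 E /vmap !fmapM !compA -(comp_pre (G2_nat _ _ _)) fmap1.
  by rewrite -!bmapM ?comp1m ?compm1.
Qed.

Lemma vmap_nat (X X' Y Y' : C) (f : hom X X') (g : hom Y Y') :
  vmap G X' Y' ∘ (fmap G f ⊗ fmap G g)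
    = fmap G (f ⊗ fmap G g) ∘ vmap G X Y.
Proof.
rewrite /vmap !compA -bmapM comul_nat comp1m.
rewrite -[X in bmap _ X _]compm1 bmapM.
by rewrite (comp_pre (G2_nat _ _ _)).
Qed.

Lemma counit_vmap (X Y : C) :
  counit G (X ⊙ G Y) ∘ vmap G X Y = counit G X ⊗ idm _.
Proof.
by rewrite /vmap (comp_pre1 (counit_G2 _ _ _)) -bmapM counit_comul compm1.
Qed.

Lemma vmap_G0l (Y : C) :
  fmap G (lunit (G Y)) ∘ vmap G (munit C) Y ∘ (G0 G ⊗ idm _)
    = comul G Y ∘ lunit (G Y).
Proof.
rewrite /vmap !compA -bmapM comp1m compm1 [G0 G ⊗ _]bmap_lr.
by rewrite (comp_pre3 (G2_lunit _ _)) lunit_nat.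
Qed.

Lemma vmap_G0r (X : C) :
  vmap G X (munit C) ∘ (idm _ ⊗ G0 G)
    = fmap G (cowarp_runit X) ∘ runit (G X).
Proof.
rewrite /vmap /cowarp_runit !compA -bmapM comp1m comul_G0.
rewrite lwhiskerM -[Z in Z ⊗ fmap G _]fmap1 (comp_pre (G2_nat _ _ _)).
rewrite -G2_runit fmapM !compA; congr (_ ∘ _).
by rewrite -[RHS]compA -fmapM runitK fmap1 comp1m.
Qed.

Definition cowarping : SkewMonoidalCategory.
Proof.
refine (@Build_SkewMonoidalCategory C cowarp_tensor (munit C)
  cowarp_assoc cowarp_lunit cowarp_runit _ _ _ _ _ _ _ _) => /=;
  move: vmap_assoc vmap_nat counit_vmap vmap_G0l vmap_G0r;
  rewrite /cowarp_assoc; generalize (vmap G) => v vA vN vC v0l v0r.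
- move=> X X' Y Y' Z Z' f g h.
  rewrite !compA assoc_nat bmap_pre vN comp1m.
  by rewrite bmap_pre compm1.
- move=> X X' f; rewrite /cowarp_lunit.
  by rewrite !compA lunit_nat (comp_pre (counit_nat _ _)).
- move=> X X' f; rewrite /cowarp_runit fmap1 bmap_pre compm1 comp1m.
  have e : runit_inv X' ∘ f = (f ⊗ idm (munit C)) ∘ runit_inv X.
    exact: (comp_inv_square (runitVK _) (runitK _) (runit_nat _)).
  by rewrite !compA e bmap_pre compm1 comp1m.
- move=> A B D E; rewrite fmap1.
  transitivity ((idm A ⊗ (v B (D ⊙ G E) ∘ (idm _ ⊗ v D E)))
      ∘ assoc A (G B) (G D ⊙ G E) ∘ assoc (A ⊙ G B) (G D) (G E)).
    rewrite !compA -bmap1 (comp_pre (assoc_nat _ _ _)).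
    by rewrite lwhiskerM compA.
  rewrite pentagon bmap_pre comp1m compA vA.
  rewrite rwhiskerM !compA.
  rewrite (comp_pre (assoc_nat _ _ _)) !bmap_pre !comp1m.
  by rewrite !compA.
- move=> A B; rewrite /cowarp_lunit fmap1 !compA.
  rewrite (comp_pre (lunit_nat _)) lunit_assoc.
  by rewrite (comp_pre1 (vC _ _)) -bmapM comp1m.
- move=> A B; rewrite fmap1 /cowarp_lunit /cowarp_runit.
  rewrite rwhiskerM !compA.
  rewrite (comp_pre (assoc_nat _ _ _)) !bmap_pre !comp1m.
  rewrite fmapM !compA v0l.
  rewrite (comp_pre1 (fmap_counit_comul _ _)) comp1m.
  rewrite (comp_pre1 (triangle _ _)) -bmapM runitVK comp1m.
  exact: bmap1.
- move=> A B; rewrite {1}/cowarp_runit !compA.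
  rewrite -bmap1 (comp_pre (assoc_nat _ _ _)) bmap_pre v0r comp1m.
  rewrite lwhiskerM !compA.
  by rewrite (comp_pre1 (runit_assoc _ _)) runitVK compm1.
- rewrite /cowarp_lunit /cowarp_runit !compA.
  rewrite (comp_pre (lunit_nat _)) lunit_runit runitVK compm1.
  exact: counit_G0.
Defined.

End Cowarping.

(* Main.v *)
From Stdlib Require Import ssreflect ssrfun.
From Stdlib Require Import FunctionalExtensionality ProofIrrelevance.
Require Import Defs.

Set Implicit Arguments.
Unset Strict Implicit.
Unset Printing Implicit Defensive.

Local Open Scope cat_scope.

(* Braidings on G and on C[G] correspond by s_X = X.y: up to the invertible map
   X.GA.GB.GC -> X.(GA.GB.GC), each axiom for s at X is the matching axiom for y
   whiskered by X. Joint epimorphy of the maps x.1 and naturality of s in X make s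
   determined by its component at X = I, hence of this form.
   A braiding c on coalgebras gives y by restriction to cofree coalgebras.
   Conversely y induces c_{A,B} = (eps.eps) y_{A,B} (alpha.beta). For this to be
   compatible with the coactions, y has to commute with comul, which is (ii) and
   (iii) with I in the appropriate place, once the unit laws
   y_{X,I} (1.G0) = G0.1 and y_{I,Z} (G0.1) = 1.G0 are known. These follow from
   (ii) and (iii) too, because y is invertible. *)

(** * Cancellation and closure properties of isomorphisms *)

Section Category.

Variable D : Category.

Lemma iso_epi (X Y Z : D) (f : hom X Y) (g h : hom Y Z) :
  is_iso f -> g ∘ f = h ∘ f -> g = h.
Proof.
move=> [k [_ fk]] e; rewrite -[g]compm1 -[h]compm1 -fk -!compA.
by rewrite e.
Qed.

Lemma iso_mono (X Y Z : D) (f : hom Y Z) (g h : hom X Y) :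
  is_iso f -> f ∘ g = f ∘ h -> g = h.
Proof.
move=> [k [kf _]] e; rewrite -[g]comp1m -[h]comp1m -kf !compA.
by rewrite e.
Qed.

Lemma is_iso_comp (X Y Z : D) (g : hom Y Z) (f : hom X Y) :
  is_iso g -> is_iso f -> is_iso (g ∘ f).
Proof.
move=> [g' [g'g gg']] [f' [f'f ff']]; exists (f' ∘ g'); split.
- by rewrite !compA (comp_pre1 g'g) comp1m.
- by rewrite !compA (comp_pre1 ff') comp1m.
Qed.

Lemma is_iso_id (X : D) : is_iso (idm X).
Proof. by exists (idm X); rewrite comp1m. Qed.

End Category.

(** * Coherence for whiskering and for fourfold products *)

Section Monoidal.

Variable C : MonoidalCategory.

Lemma is_iso_bmap (X X' Y Y' : C) (f : hom X X') (g : hom Y Y') :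
  is_iso f -> is_iso g -> is_iso (f ⊗ g).
Proof.
move=> [f' [f'f ff']] [g' [g'g gg']]; exists (f' ⊗ g').
by rewrite -!bmapM f'f ff' g'g gg' !bmap1.
Qed.

Lemma is_iso_assoc (X Y Z : C) : is_iso (assoc X Y Z).
Proof. by exists (assoc_inv X Y Z); rewrite assocK assocVK. Qed.

Lemma is_iso_assoc_inv (X Y Z : C) : is_iso (assoc_inv X Y Z).
Proof. by exists (assoc X Y Z); rewrite assocK assocVK. Qed.

Lemma is_iso_lunit (X : C) : is_iso (lunit X).
Proof. by exists (lunit_inv X); rewrite lunitK lunitVK. Qed.

Lemma is_iso_lunit_inv (X : C) : is_iso (lunit_inv X).
Proof. by exists (lunit X); rewrite lunitK lunitVK. Qed.

Lemma is_iso_runit (X : C) : is_iso (runit X).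
Proof. by exists (runit_inv X); rewrite runitK runitVK. Qed.

Lemma is_iso_mid (X Y Z Y' Z' : C) (f : hom (Y ⊙ Z) (Y' ⊙ Z')) :
  is_iso f -> is_iso (mid X f).
Proof.
move=> f_iso; apply: is_iso_comp; first exact: is_iso_assoc_inv.
apply: is_iso_comp; last exact: is_iso_assoc.
by apply: is_iso_bmap; first exact: is_iso_id.
Qed.

Lemma assoc_mid (X Y Z Y' Z' : C) (f : hom (Y ⊙ Z) (Y' ⊙ Z')) :
  assoc X Y' Z' ∘ mid X f = (idm X ⊗ f) ∘ assoc X Y Z.
Proof. by rewrite /mid (comp_pre1 (assocVK _ _ _)) comp1m. Qed.

(** Only one commuting square is assumed, not a natural family, so this also applies to squares such
    as [coact_descend]. *)
Lemma mid_nat (X X' Y1 Z1 Y2 Z2 Y1' Z1' Y2' Z2' : C) (x : hom X X')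
    (f : hom (Y1 ⊙ Z1) (Y2 ⊙ Z2)) (f' : hom (Y1' ⊙ Z1') (Y2' ⊙ Z2'))
    (g1 : hom Y1 Y1') (h1 : hom Z1 Z1') (g2 : hom Y2 Y2') (h2 : hom Z2 Z2') :
  f' ∘ (g1 ⊗ h1) = (g2 ⊗ h2) ∘ f ->
  mid X' f' ∘ (x ⊗ g1 ⊗ h1) = (x ⊗ g2 ⊗ h2) ∘ mid X f.
Proof.
move=> e; apply: assoc_mono.
rewrite (comp_pre (assoc_mid _ _)) assoc_nat (comp_pre (assoc_nat _ _ _)).
by rewrite assoc_mid !bmap_pre e comp1m compm1.
Qed.

Lemma mid_unit (Y Z Y' Z' : C) (f : hom (Y ⊙ Z) (Y' ⊙ Z')) :
  (lunit Y' ⊗ idm Z') ∘ mid (munit C) f = f ∘ (lunit Y ⊗ idm Z).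
Proof.
rewrite -!lunit_assoc compA assoc_mid.
by rewrite (comp_pre (lunit_nat _)).
Qed.

(** Splits off X and leaves the other three factors bracketed to the left, as in the axioms for
    y. *)
Definition assoc4 (X Y Z W : C) :
    hom (X ⊙ Y ⊙ Z ⊙ W) (X ⊙ (Y ⊙ Z ⊙ W)) :=
  assoc X (Y ⊙ Z) W ∘ (assoc X Y Z ⊗ idm W).

Lemma is_iso_assoc4 (X Y Z W : C) : is_iso (assoc4 X Y Z W).
Proof.
apply: is_iso_comp; first exact: is_iso_assoc.
by apply: is_iso_bmap; [exact: is_iso_assoc | exact: is_iso_id].
Qed.

Lemma assoc4_pentagon (X Y Z W : C) :
  (idm X ⊗ assoc Y Z W) ∘ assoc4 X Y Z W
    = assoc X Y (Z ⊙ W) ∘ assoc (X ⊙ Y) Z W.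
Proof. by rewrite pentagon. Qed.

Lemma assoc4_mid_left (X Y Z Y' Z' W : C) (f : hom (Y ⊙ Z) (Y' ⊙ Z')) :
  assoc4 X Y' Z' W ∘ (mid X f ⊗ idm W)
    = (idm X ⊗ (f ⊗ idm W)) ∘ assoc4 X Y Z W.
Proof.
rewrite /assoc4 compA -rwhiskerM assoc_mid rwhiskerM.
by rewrite (comp_pre (assoc_nat _ _ _)).
Qed.

(** After one more associator the pentagon replaces [assoc4] by two successive associators, and
    [mid] passes each of them. *)
Lemma assoc4_mid_right (X Y Z W Z' W' : C) (f : hom (Z ⊙ W) (Z' ⊙ W')) :
  assoc4 X Y Z' W' ∘ mid (X ⊙ Y) f
    = (idm X ⊗ mid Y f) ∘ assoc4 X Y Z W.
Proof.
have: is_iso (idm X ⊗ assoc Y Z' W').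
  by apply: is_iso_bmap; [exact: is_iso_id | exact: is_iso_assoc].
move/iso_mono; apply.
rewrite (comp_pre (assoc4_pentagon _ _ _ _)) assoc_mid.
rewrite -bmap1 (comp_pre (assoc_nat _ _ _)) -assoc4_pentagon.
by rewrite !bmap_pre !comp1m assoc_mid.
Qed.

Lemma assoc_inv_nat (X X' Y Y' Z Z' : C)
    (f : hom X X') (g : hom Y Y') (h : hom Z Z') :
  assoc_inv X' Y' Z' ∘ (f ⊗ (g ⊗ h)) = (f ⊗ g ⊗ h) ∘ assoc_inv X Y Z.
Proof.
apply: (comp_inv_square (assocVK _ _ _) (assocK _ _ _)).
exact: assoc_nat.
Qed.

Lemma triangle_inv (X Y : C) :
  assoc X (munit C) Y ∘ (runit_inv X ⊗ idm Y) = idm X ⊗ lunit_inv Y.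
Proof.
have lunit_iso : is_iso (idm X ⊗ lunit Y).
  by apply: is_iso_bmap; [exact: is_iso_id | exact: is_iso_lunit].
apply: (iso_mono lunit_iso); rewrite (comp_pre1 (triangle _ _)) -!bmapM.
by rewrite runitVK lunitVK !comp1m.
Qed.

End Monoidal.

(** * Braidings are determined by their components *)

Lemma ComonadBraiding_ext (C : MonoidalCategory) (G : MonoidalComonad C)
    (y z : ComonadBraiding G) :
  (forall A B, cbraid y A B = cbraid z A B) -> y = z.
Proof.
case: y z => [y y1 y2 y3 y4 y5 y6] [z z1 z2 z3 z4 z5 z6] /= e.
have {}e : y = z.
  by apply: functional_extensionality_dep => A;
     apply: functional_extensionality_dep => B.
by subst z; f_equal; apply: proof_irrelevance.
Qed.

Lemma Braiding_ext (M : MonoidalCategory) (b c : Braiding M) :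
  (forall A B, braid b A B = braid c A B) -> b = c.
Proof.
case: b c => [b b1 b2 b3 b4] [c c1 c2 c3 c4] /= e.
have {}e : b = c.
  by do 2 (apply: functional_extensionality_dep => ?).
by subst c; f_equal; apply: proof_irrelevance.
Qed.

Lemma SkewBraiding_ext (S : SkewMonoidalCategory) (s t : SkewBraiding S) :
  (forall X A B, sbraid s X A B = sbraid t X A B) -> s = t.
Proof.
case: s t => [s s1 s2 s3 s4 s5 s6] [t t1 t2 t3 t4 t5 t6] /= e.
have {}e : s = t.
  by do 3 (apply: functional_extensionality_dep => ?).
by subst t; f_equal; apply: proof_irrelevance.
Qed.

(** * Braidings on G and braidings on C[G] *)

Section CowarpedBraiding.

Variables (C : MonoidalCategory) (G : MonoidalComonad C).

(* Each axiom of a braiding on [cowarping G], instantiated at X and [mid X y],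
   is the corresponding axiom for y whiskered by X. *)
Section Whiskering.

Variable y : forall A B : C, hom (G A ⊙ G B) (G B ⊙ G A).

Lemma assoc4_yb_left (X A B D : C) :
  assoc4 X _ _ _ ∘ mid (X ⊙ G D) (y A B) ∘ (mid X (y A D) ⊗ idm _)
      ∘ mid (X ⊙ G A) (y B D)
    = (idm X ⊗ (mid (G D) (y A B) ∘ (y A D ⊗ idm _) ∘ mid (G A) (y B D)))
      ∘ assoc4 X _ _ _.
Proof.
rewrite (comp_pre (assoc4_mid_right _ _ _)) (comp_pre (assoc4_mid_left _ _ _)).
by rewrite assoc4_mid_right !bmap_pre !comp1m ?compA.
Qed.

Lemma assoc4_yb_right (X A B D : C) :
  assoc4 X _ _ _ ∘ (mid X (y B D) ⊗ idm _) ∘ mid (X ⊙ G B) (y A D)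
      ∘ (mid X (y A B) ⊗ idm _)
    = (idm X ⊗ ((y B D ⊗ idm _) ∘ mid (G B) (y A D) ∘ (y A B ⊗ idm _)))
      ∘ assoc4 X _ _ _.
Proof.
rewrite (comp_pre (assoc4_mid_left _ _ _)) (comp_pre (assoc4_mid_right _ _ _)).
by rewrite assoc4_mid_left !bmap_pre !comp1m ?compA.
Qed.

Lemma assoc_cowarp_assoc_l (X A B D : C) :
  assoc X _ _ ∘ (cowarp_assoc G X A B ⊗ idm D)
    = (idm X ⊗ (vmap G A B ⊗ idm D)) ∘ assoc4 X _ _ D.
Proof.
by rewrite /cowarp_assoc rwhiskerM (comp_pre (assoc_nat _ _ _)).
Qed.

Lemma assoc_cowarp_assoc_r (X Y A B : C) :
  assoc X Y _ ∘ cowarp_assoc G (X ⊙ Y) A B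
    = (idm X ⊗ ((idm Y ⊗ vmap G A B) ∘ assoc Y (G A) (G B)))
      ∘ assoc4 X Y (G A) (G B).
Proof.
rewrite lwhiskerM compA assoc4_pentagon /cowarp_assoc -bmap1.
by rewrite (comp_pre (assoc_nat _ _ _)).
Qed.

Lemma assoc_v_right_left (X A B D : C) :
  assoc X _ _ ∘ mid X (y A (B ⊙ G D)) ∘ cowarp_assoc G (X ⊙ G A) B D
    = (idm X ⊗ (y A (B ⊙ G D) ∘ (idm _ ⊗ vmap G B D) ∘ assoc _ _ _))
      ∘ assoc4 X _ _ _.
Proof.
rewrite (comp_pre (assoc_mid _ _)) assoc_cowarp_assoc_r.
by rewrite !bmap_pre !comp1m ?compA.
Qed.

Lemma assoc_v_right_right (X A B D : C) :
  assoc X _ _ ∘ (cowarp_assoc G X B D ⊗ idm _) ∘ mid (X ⊙ G B) (y A D)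
      ∘ (mid X (y A B) ⊗ idm _)
    = (idm X ⊗ ((vmap G B D ⊗ idm _) ∘ mid (G B) (y A D) ∘ (y A B ⊗ idm _)))
      ∘ assoc4 X _ _ _.
Proof.
rewrite (comp_pre (assoc_cowarp_assoc_l _ _ _ _)).
rewrite (comp_pre (assoc4_mid_right _ _ _)) assoc4_mid_left.
by rewrite !bmap_pre !comp1m ?compA.
Qed.

Lemma assoc_v_left_left (X A B D : C) :
  assoc X _ _ ∘ mid X (y (A ⊙ G B) D) ∘ (cowarp_assoc G X A B ⊗ idm _)
    = (idm X ⊗ (y (A ⊙ G B) D ∘ (vmap G A B ⊗ idm _))) ∘ assoc4 X _ _ _.
Proof.
rewrite (comp_pre (assoc_mid _ _)) assoc_cowarp_assoc_l.
by rewrite !bmap_pre !comp1m ?compA.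
Qed.

Lemma assoc_v_left_right (X A B D : C) :
  assoc X _ _ ∘ cowarp_assoc G (X ⊙ G D) A B ∘ (mid X (y A D) ⊗ idm _)
      ∘ mid (X ⊙ G A) (y B D)
    = (idm X ⊗ ((idm _ ⊗ vmap G A B) ∘ assoc _ _ _ ∘ (y A D ⊗ idm _)
        ∘ mid (G A) (y B D))) ∘ assoc4 X _ _ _.
Proof.
rewrite (comp_pre (assoc_cowarp_assoc_r _ _ _ _)).
rewrite (comp_pre (assoc4_mid_left _ _ _)) assoc4_mid_right.
by rewrite !bmap_pre !comp1m ?compA.
Qed.

(** The target already has X split off, so (B4), unlike (B1)-(B3), is rebracketed only at its
    source. *)
Lemma cowarp_assoc_twice (X A B D : C) :
  cowarp_assoc G X (A ⊙ G B) D ∘ (cowarp_assoc G X A B ⊗ idm _)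
    = (idm X ⊗ (vmap G (A ⊙ G B) D ∘ (vmap G A B ⊗ idm _)))
      ∘ assoc4 X _ _ _.
Proof.
rewrite /cowarp_assoc /= compA assoc_cowarp_assoc_l.
by rewrite !bmap_pre !comp1m.
Qed.

Lemma v_v_left (X A B D : C) :
  (idm X ⊗ fmap G (mid A (y B D))) ∘ cowarp_assoc G X (A ⊙ G B) D
      ∘ (cowarp_assoc G X A B ⊗ idm _)
    = (idm X ⊗ (fmap G (mid A (y B D)) ∘ vmap G (A ⊙ G B) D
        ∘ (vmap G A B ⊗ idm _))) ∘ assoc4 X _ _ _.
Proof. by rewrite cowarp_assoc_twice bmap_pre comp1m. Qed.

Lemma v_v_right (X A B D : C) :
  cowarp_assoc G X (A ⊙ G D) B ∘ (cowarp_assoc G X A D ⊗ idm _)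
      ∘ mid (X ⊙ G A) (y B D)
    = (idm X ⊗ (vmap G (A ⊙ G D) B ∘ (vmap G A D ⊗ idm _)
        ∘ mid (G A) (y B D))) ∘ assoc4 X _ _ _.
Proof.
rewrite (comp_pre (cowarp_assoc_twice _ _ _ _)) assoc4_mid_right.
by rewrite !bmap_pre !comp1m ?compA.
Qed.

End Whiskering.

Definition skew_of_comonad_braiding (y : ComonadBraiding G) :
  SkewBraiding (cowarping G).
Proof.
refine (@Build_SkewBraiding (cowarping G) (fun X A B => mid X (cbraid y A B))
  _ _ _ _ _ _) => /=.
- by move=> X X' A A' B B' f g h; apply: mid_nat; apply: cbraid_nat.
- by move=> X A B; apply: is_iso_mid; apply: cbraid_iso.
- move=> X A B D; rewrite !fmap1; apply: (iso_mono (is_iso_assoc4 _ _ _ _)).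
  by rewrite assoc4_yb_left assoc4_yb_right cbraid_yang_baxter.
- move=> X A B D; rewrite !fmap1; apply: assoc_mono.
  by rewrite assoc_v_right_left assoc_v_right_right cbraid_v_right.
- move=> X A B D; rewrite !fmap1; apply: assoc_mono.
  by rewrite assoc_v_left_left assoc_v_left_right cbraid_v_left.
- by move=> X A B D; rewrite !fmap1 v_v_left v_v_right cbraid_v_v.
Defined.

Section Backward.

Hypothesis munit_jointly_epi : forall X A : C,
  jointly_epi (fun x : hom (munit C) X => x ⊗ idm A).

Variable s : SkewBraiding (cowarping G).

(** The component of s at I, transported along I.GA = GA. The ascription reads the product of C[G]
    as a tensor product in C. *)
Definition unit_part (A B : C) : hom (G A ⊙ G B) (G B ⊙ G A) :=
  (lunit _ ⊗ idm _) ∘ (sbraid s (munit C) A B : hom (_ ⊙ _) (_ ⊙ _))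
    ∘ (lunit_inv _ ⊗ idm _).

Lemma mid_unit_unit_part (A B : C) :
  mid (munit C) (unit_part A B) = sbraid s (munit C) A B.
Proof.
have: is_iso (lunit (G B) ⊗ idm (G A)).
  by apply: is_iso_bmap; [exact: is_iso_lunit | exact: is_iso_id].
move/iso_mono; apply.
rewrite mid_unit /unit_part !compA -rwhiskerM lunitK bmap1.
by rewrite compm1.
Qed.

Lemma mid_unit_part (X A B : C) : mid X (unit_part A B) = sbraid s X A B.
Proof.
(* Naturality of s and of [mid] in X along x reduces the claim to the component at I. *)
have key (x : hom (munit C) X) : mid X (unit_part A B) ∘ (x ⊗ idm _ ⊗ idm _)
    = sbraid s X A B ∘ (x ⊗ idm _ ⊗ idm _).
  rewrite (mid_nat x (f := unit_part A B) (g2 := idm _) (h2 := idm _)).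
    by rewrite !bmap1 comp1m compm1.
  have := sbraid_nat s x (idm A : hom (A : cowarping G) A)
    (idm B : hom (B : cowarping G) B).
  by rewrite /= !fmap1 mid_unit_unit_part => ->.
(* Joint epimorphy concerns x.1 with one factor on the right, so GA.GB is first bracketed
   together. *)
apply: (iso_epi (is_iso_assoc_inv X (G A) (G B))).
apply: munit_jointly_epi => x; apply: assoc_epi.
move: (mid X _) key => m key; rewrite !compA -bmap1 -assoc_nat.
by rewrite !(comp_pre1 (assocK _ _ _)) comp1m.
Qed.

(** Whiskering by I loses nothing, so (i)-(iv) can be checked there, where they are (B1)-(B4) at X =
    I. *)
Lemma munit_whisker_inj (A B D Y : C) (f g : hom (A ⊙ B ⊙ D) Y) :
  (idm (munit C) ⊗ f) ∘ assoc4 _ A B D = (idm _ ⊗ g) ∘ assoc4 _ A B D ->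
  f = g.
Proof. by move/(iso_epi (is_iso_assoc4 _ _ _ _))/lwhisker_inj. Qed.

Definition comonad_braiding_of_skew : ComonadBraiding G.
Proof.
refine (@Build_ComonadBraiding C G unit_part _ _ _ _ _ _).
- move=> X X' Y Y' f g; apply: lwhisker_inj; apply: assoc_epi.
  have := sbraid_nat s (idm (munit C) : hom (munit C : cowarping G) (munit C))
    (f : hom (X : cowarping G) X') (g : hom (Y : cowarping G) Y').
  rewrite /= -!mid_unit_part => /(f_equal (comp (assoc _ _ _))).
  rewrite (comp_pre (assoc_mid _ _)) (comp_pre (assoc_nat _ _ _)).
  by rewrite assoc_nat assoc_mid !bmap_pre !comp1m.
- move=> X Y; apply: is_iso_comp.
    by apply: is_iso_bmap; [exact: is_iso_lunit | exact: is_iso_id].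
  apply: is_iso_comp; first exact: (sbraid_iso s (munit C) X Y).
  by apply: is_iso_bmap; [exact: is_iso_lunit_inv | exact: is_iso_id].
- move=> X Y Z; apply: munit_whisker_inj.
  rewrite -assoc4_yb_left -assoc4_yb_right !mid_unit_part.
  have := sbraid_yang_baxter s (munit C) X Y Z.
  by rewrite /= !fmap1 => ->.
- move=> X Y Z; apply: munit_whisker_inj.
  rewrite -assoc_v_right_left -assoc_v_right_right !mid_unit_part.
  have := sbraid_assoc_right s (munit C) X Y Z.
  by rewrite /= !fmap1 => ->.
- move=> X Y Z; apply: munit_whisker_inj.
  rewrite -assoc_v_left_left -assoc_v_left_right !mid_unit_part.
  have := sbraid_assoc_left s (munit C) X Y Z.
  by rewrite /= !fmap1 => ->.
- move=> X Y Z; apply: munit_whisker_inj.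
  rewrite -v_v_left -v_v_right !mid_unit_part.
  have := sbraid_assoc_assoc s (munit C) X Y Z.
  by rewrite /= !fmap1 => ->.
Defined.

End Backward.

Lemma skew_of_comonad_braiding_bijective :
  (forall X A : C, jointly_epi (fun x : hom (munit C) X => x ⊗ idm A)) ->
  bijective skew_of_comonad_braiding.
Proof.
move=> munit_jointly_epi.
exists (comonad_braiding_of_skew munit_jointly_epi).
- move=> y; apply: ComonadBraiding_ext => A B.
  apply: lwhisker_inj; apply: assoc_epi; rewrite -!assoc_mid; congr (_ ∘ _).
  exact: mid_unit_part.
- by move=> s; apply: SkewBraiding_ext => X A B; apply: mid_unit_part.
Qed.

End CowarpedBraiding.

(** * The hexagons in the bracketing of the axioms for y *)

Section Braided.

Variables (C : MonoidalCategory) (c : Braiding C).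

Lemma braid_right (A B D : C) :
  braid c A (B ⊙ D) ∘ assoc A B D
    = mid B (braid c A D) ∘ (braid c A B ⊗ idm D).
Proof.
apply: assoc_mono; rewrite (comp_pre (assoc_mid _ _)).
exact: braid_hexagon1.
Qed.

Lemma braid_left (A B D : C) :
  braid c (A ⊙ B) D
    = assoc D A B ∘ (braid c A D ⊗ idm B) ∘ mid A (braid c B D).
Proof.
apply: (iso_mono (is_iso_assoc_inv _ _ _)).
rewrite (comp_pre1 (assocK _ _ _)) comp1m.
apply: (iso_epi (is_iso_assoc_inv _ _ _)).
rewrite /mid !compA assocVK compm1.
exact: braid_hexagon2.
Qed.

(** By the first hexagon the two sides braid A past B.D and past D.B, so they agree by naturality
    along the braiding of B with D. *)
Lemma braid_yang_baxter (A B D : C) :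
  (braid c B D ⊗ idm A) ∘ mid B (braid c A D) ∘ (braid c A B ⊗ idm D)
    = mid D (braid c A B) ∘ (braid c A D ⊗ idm B) ∘ mid A (braid c B D).
Proof.
rewrite -braid_right -[RHS](comp_pre (braid_right _ _ _)) assoc_mid.
by rewrite -(comp_pre (braid_nat _ _ _)).
Qed.

End Braided.

(** * Cofree coalgebras and v as a coalgebra morphism *)

Section Coalgebras.

Variables (C : MonoidalCategory) (G : MonoidalComonad C).

Definition cofree (X : C) : Coalgebra G.
Proof.
by exists (G X) (comul G X); [exact: counit_comul | exact: comulA].
Defined.

Definition cofree_map (X Y : C) (f : hom X Y) : CoalgHom (cofree X) (cofree Y).
Proof. by exists (fmap G f); exact: comul_nat. Defined.

(** The unit of the adjunction between the forgetful functor and the cofree coalgebra functor. *)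
Definition coact_hom (A : Coalgebra G) : CoalgHom A (cofree A).
Proof. by exists (coact A); exact: coact_comul. Defined.

(** Links tensor products of coalgebras to v, so that (ii) and (iii) can be applied to them. It
    combines naturality of [G2] with coassociativity of the coaction of B. *)
Lemma vmap_coact (A B : Coalgebra G) :
  fmap G (idm A ⊗ coact B) ∘ coact (coalg_tensor_ob A B)
    = vmap G A B ∘ (coact A ⊗ coact B).
Proof.
rewrite /= -(comp_pre (G2_nat _ _ _)) /vmap !compA -!bmapM fmap1 !comp1m.
by rewrite coact_comul.
Qed.

(** The coalgebra morphism into a cofree coalgebra that corresponds to eps.1. Naturality of a
    coalgebra braiding along it yields (ii) and (iii). *)
Definition vmap_hom (X Y : C) :
  CoalgHom (coalg_tensor_ob (cofree X) (cofree Y)) (cofree (X ⊙ G Y)).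
Proof.
exists (vmap G X Y) => /=.
rewrite /vmap (comp_pre1 (comul_G2 _ _ _)) !compA -bmapM compm1 comulA.
rewrite fmapM !compA -(comp_pre (G2_nat _ _ _)) -bmapM.
by rewrite fmap1 comp1m.
Defined.

(** Rewrites both sides of (iv) in terms of the coactions on GY.GZ and GZ.GY, so that (iv) expresses
    that y respects these coactions. *)
Lemma assoc_vmap_twice (X Y Z : C) :
  fmap G (assoc X _ _) ∘ vmap G (X ⊙ G Y) Z ∘ (vmap G X Y ⊗ idm _)
    = G2 G X (G Y ⊙ G Z)
      ∘ (idm _ ⊗ coact (coalg_tensor_ob (cofree Y) (cofree Z)))
      ∘ assoc (G X) (G Y) (G Z).
Proof.
have -> : vmap G (X ⊙ G Y) Z ∘ (vmap G X Y ⊗ idm _)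
    = G2 G (X ⊙ G Y) (G Z) ∘ (G2 G X (G Y) ⊗ idm _)
      ∘ (idm (G X) ⊗ comul G Y ⊗ comul G Z).
  by rewrite /vmap !compA -!bmapM !comp1m !compm1.
rewrite (comp_pre3 (G2_assoc _ _ _ _)) /= lwhiskerM !compA.
by rewrite assoc_nat.
Qed.

(** * From braidings on coalgebras to braidings on G *)

Section Backward.

Variable c : Braiding (coalg_monoidal G).

Definition cofree_braid (X Y : C) : hom (G X ⊙ G Y) (G Y ⊙ G X) :=
  coalg_mor (braid c (cofree X) (cofree Y)).

Lemma coalg_braid_nat (A A' B B' : Coalgebra G)
    (f : CoalgHom A A') (g : CoalgHom B B') :
  coalg_mor (braid c A' B') ∘ (coalg_mor f ⊗ coalg_mor g)
    = (coalg_mor g ⊗ coalg_mor f) ∘ coalg_mor (braid c A B).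
Proof. exact: (f_equal (@coalg_mor _ _ _ _) (braid_nat c f g)). Qed.

Definition comonad_braiding_of_coalg : ComonadBraiding G.
Proof.
refine (@Build_ComonadBraiding C G cofree_braid _ _ _ _ _ _).
- move=> X X' Y Y' f g.
  exact: (coalg_braid_nat (cofree_map f) (cofree_map g)).
- move=> X Y; have [d [dc cd]] := braid_iso c (cofree X) (cofree Y).
  exists (coalg_mor d); split.
  + exact: (f_equal (@coalg_mor _ _ _ _) dc).
  + exact: (f_equal (@coalg_mor _ _ _ _) cd).
- move=> X Y Z.
  exact: (f_equal (@coalg_mor _ _ _ _)
    (braid_yang_baxter c (cofree X) (cofree Y) (cofree Z))).
(* (ii) is the first hexagon at cofree coalgebras, followed by naturality along v; (iii) is obtained
   likewise from the second. *)
- move=> X Y Z.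
  have := f_equal (@coalg_mor _ _ _ _)
    (braid_right c (cofree X) (cofree Y) (cofree Z)).
  rewrite /= => e.
  have := coalg_braid_nat (coalg_id (cofree X)) (vmap_hom Y Z).
  rewrite /= => e'; rewrite (comp_pre e') /cofree_braid.
  by rewrite -[in RHS]e.
- move=> X Y Z.
  have := f_equal (@coalg_mor _ _ _ _)
    (braid_left c (cofree X) (cofree Y) (cofree Z)).
  rewrite /= => e.
  have := coalg_braid_nat (vmap_hom X Y) (coalg_id (cofree Z)).
  by rewrite /= e => e'; rewrite /cofree_braid e'.
- move=> X Y Z.
  have assoc_iso : is_iso (fmap G (assoc X (G Z) (G Y))).
    by exists (fmap G (assoc_inv X _ _)); rewrite -!fmapM assocK assocVK !fmap1.
  apply: (iso_mono assoc_iso).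
  (* Once [assoc_vmap_twice] is applied to both sides, (iv) follows from the braiding being a
     coalgebra morphism. *)
  have e := coalg_morP (braid c (cofree Y) (cofree Z)).
  rewrite (comp_pre1 (esym (fmapM _ _ _))) assoc_mid fmapM compA assoc_vmap_twice.
  rewrite -(comp_pre (G2_nat _ _ _)) fmap1 bmap_pre comp1m -e.
  rewrite (comp_pre3 (assoc_vmap_twice _ _ _)) !compA assoc_mid.
  by rewrite bmap_pre comp1m [in RHS]/= compA.
Defined.

End Backward.

(** * From braidings on G to coalgebras: unit laws and compatibility with [comul] *)

Section Forward.

Variable y : ComonadBraiding G.

Lemma assoc_cowarp_runit (X Y : C) :
  assoc X (G (munit C)) Y ∘ (cowarp_runit G X ⊗ idm Y)
    = idm X ⊗ ((G0 G ⊗ idm Y) ∘ lunit_inv Y).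
Proof.
rewrite rwhiskerM (comp_pre (assoc_nat _ _ _)) triangle_inv -bmapM.
by rewrite comp1m.
Qed.

Lemma cbraid_unit_right (X : C) :
  cbraid y X (munit C) ∘ (idm _ ⊗ G0 G)
    = (G0 G ⊗ idm _) ∘ lunit_inv _ ∘ runit (G X).
Proof.
set w := LHS.
(* (ii) at Z = I, precomposed with G0; invertibility of y removes y_{X,Y}. *)
have step (Y : C) : (fmap G (cowarp_runit G Y) ⊗ idm _) ∘ runit (G Y ⊙ G X)
    = (vmap G Y (munit C) ⊗ idm _) ∘ assoc_inv _ _ _ ∘ (idm (G Y) ⊗ w)
      ∘ assoc _ _ _.
  have y_iso : is_iso (cbraid y X Y ⊗ idm (munit C)).
    by apply: is_iso_bmap; [exact: cbraid_iso | exact: is_iso_id].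
  apply: (iso_epi y_iso).
  transitivity (cbraid y X (Y ⊙ G (munit C)) ∘ (idm (G X) ⊗ vmap G Y (munit C))
     ∘ assoc (G X) (G Y) (G (munit C)) ∘ (idm (G X) ⊗ idm (G Y) ⊗ G0 G)).
    rewrite assoc_nat bmap_pre vmap_G0r comp1m lwhiskerM !compA runit_assoc.
    rewrite runit_nat -fmap1 -(comp_pre (cbraid_nat y _ _)).
    by rewrite fmap1.
  have -> : (idm (G X) ⊗ idm (G Y) ⊗ G0 G)
      = idm (G X ⊙ G Y) ⊗ G0 G by rewrite bmap1.
  rewrite (comp_pre3 (cbraid_v_right y _ _ _)) !compA -bmapM comp1m compm1.
  have -> : cbraid y X Y ⊗ G0 G
      = (idm (G Y) ⊗ idm (G X) ⊗ G0 G) ∘ (cbraid y X Y ⊗ idm _).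
    by rewrite bmap1 -bmapM comp1m compm1.
  by rewrite (comp_pre (assoc_nat _ _ _)) bmap_pre comp1m.
(* At Y = I, eps after v is eps.1 and eps cancels [G0], so only [w] whiskered by I remains on the
   right. *)
have := f_equal (fun h => (counit G _ ⊗ idm _) ∘ h ∘ (G0 G ⊗ idm _ ⊗ idm _))
  (step (munit C)).
rewrite /= !compA runit_nat assoc_nat bmap1 !bmap_pre !comp1m counit_nat.
rewrite !compA counit_G0 compm1 counit_vmap.
rewrite compm1 -(comp_pre (assoc_inv_nat _ _ _)) bmap1 bmap_pre counit_G0 comp1m.
rewrite -/w -/(cowarp_runit G (munit C)) => /(f_equal (comp (assoc _ _ _))).
rewrite (comp_pre1 (assoc_cowarp_runit _ _)) (comp_pre1 (assocVK _ _ _)) comp1m.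
rewrite -runit_assoc bmap_pre comp1m compA => /assoc_epi /lwhisker_inj e.
by rewrite e.
Qed.

(** [vmap_G0r] produces the right unit map of C[G], so this is G applied to the skew axiom relating
    the two unit maps at I. *)
Lemma counit_vmap_unit_right :
  fmap G (counit G (munit C) ∘ lunit (G (munit C)))
      ∘ vmap G (munit C) (munit C) ∘ (idm _ ⊗ G0 G)
    = runit (G (munit C)).
Proof.
rewrite vmap_G0r (comp_pre1 (esym (fmapM _ _ _))).
by rewrite (slunit_srunit (cowarping G)) fmap1 comp1m.
Qed.

(* (iii) at X = I. *)
Lemma cbraid_v_unit_left (Y Z : C) :
  (idm (G Z) ⊗ (fmap G (lunit (G Y)) ∘ vmap G (munit C) Y)) ∘ assoc _ _ _
      ∘ ((cbraid y (munit C) Z ∘ (G0 G ⊗ idm _)) ⊗ idm _)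
      ∘ mid (munit C) (cbraid y Y Z)
    = cbraid y (G Y) Z ∘ (comul G Y ⊗ idm _) ∘ (lunit (G Y) ⊗ idm _).
Proof.
have -> : (comul G Y ⊗ idm (G Z)) ∘ (lunit (G Y) ⊗ idm _)
    = (fmap G (lunit (G Y)) ⊗ fmap G (idm Z)) ∘ (vmap G (munit C) Y ⊗ idm _)
      ∘ (G0 G ⊗ idm _ ⊗ idm _).
  by rewrite -!bmapM -vmap_G0l fmap1 !comp1m.
rewrite (comp_pre (cbraid_nat y _ _)) (comp_pre1 (cbraid_v_left y _ _ _)).
rewrite ![in RHS](compA (_ ⊗ _)) [in RHS](compA (assoc _ _ _)) (compA (_ ⊗ _)).
rewrite (mid_nat (G0 G) (f := cbraid y Y Z) (g2 := idm _) (h2 := idm _)).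
  by rewrite !bmap1 comp1m compm1.
by rewrite fmap1 !bmap_pre !comp1m.
Qed.

Lemma cbraid_unit_left (Z : C) :
  cbraid y (munit C) Z ∘ (G0 G ⊗ idm _)
    = (idm _ ⊗ G0 G) ∘ runit_inv _ ∘ lunit (G Z).
Proof.
set q := LHS.
(* Invertibility of y removes y_{Y,Z}. *)
have step (Y : C) : (idm (G Z) ⊗ (fmap G (counit G Y ∘ lunit (G Y))
      ∘ vmap G (munit C) Y)) ∘ assoc _ _ _ ∘ (q ⊗ idm _)
    = lunit (G Z) ⊗ idm (G Y).
  apply: (iso_epi (is_iso_mid (munit C) (cbraid_iso y Y Z))).
  rewrite mid_unit fmapM [X in idm _ ⊗ X]compA.
  rewrite lwhiskerM 3!compA cbraid_v_unit_left -fmap1.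
  rewrite -(comp_pre (cbraid_nat y _ _)) bmap_pre fmap_counit_comul fmap1.
  by rewrite comp1m bmap1 comp1m.
clearbody q; apply: (iso_epi (is_iso_runit _)).
(* Taking Y = I and inserting [G0] in the last factor cancels v and isolates [q]. *)
have e : q ∘ runit _ = lunit (G Z) ⊗ G0 G.
  have -> : lunit (G Z) ⊗ G0 G = (lunit (G Z) ⊗ idm _) ∘ (idm _ ⊗ G0 G).
    by rewrite -bmapM comp1m compm1.
  rewrite -step !compA -bmapM comp1m compm1.
  have -> : q ⊗ G0 G = (idm _ ⊗ idm _ ⊗ G0 G) ∘ (q ⊗ idm _).
    by rewrite bmap1 -bmapM comp1m compm1.
  rewrite (comp_pre (assoc_nat _ _ _)) bmap_pre comp1m compA.
  by rewrite counit_vmap_unit_right (comp_pre1 (runit_assoc _ _)) runit_nat.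
rewrite e !compA -runit_nat (comp_pre1 (runitK _)) comp1m -bmapM.
by rewrite comp1m compm1.
Qed.

(** Inserting [G0] into v at X = I gives [comul] up to [lunit]; the unit law carries [G0] past GZ in
    (iii). *)
Lemma cbraid_comul_left (Y Z : C) :
  cbraid y (G Y) Z ∘ (comul G Y ⊗ idm _) = (idm _ ⊗ comul G Y) ∘ cbraid y Y Z.
Proof.
have lunit_iso : is_iso (lunit (G Y) ⊗ idm (G Z)).
  by apply: is_iso_bmap; [exact: is_iso_lunit | exact: is_iso_id].
apply: (iso_epi lunit_iso); rewrite !compA -cbraid_v_unit_left cbraid_unit_left.
rewrite -mid_unit.
rewrite 2!rwhiskerM !(compA (_ ⊗ _)) (comp_pre (assoc_nat _ _ _)).
rewrite (comp_pre1 (triangle_inv _ _)) !bmap_pre !comp1m.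
congr ((_ ⊗ _) ∘ _).
by rewrite !compm1 [X in X ∘ lunit_inv _]compA vmap_G0l compA lunitVK compm1.
Qed.

(** The same argument with (ii) at Y = I, where [G0] is inserted in the middle factor and moved to
    the front. *)
Lemma cbraid_comul_right (X Z : C) :
  cbraid y X (G Z) ∘ (idm _ ⊗ comul G Z) = (comul G Z ⊗ idm _) ∘ cbraid y X Z.
Proof.
apply: (iso_epi (is_iso_bmap (is_iso_runit (G X)) (is_iso_id (G Z)))).
transitivity ((fmap G (lunit (G Z)) ⊗ fmap G (idm X)) ∘ cbraid y X (munit C ⊙ G Z)
   ∘ (idm (G X) ⊗ vmap G (munit C) Z) ∘ assoc _ _ _
   ∘ ((idm _ ⊗ G0 G) ⊗ idm _)).
  rewrite -(comp_pre (cbraid_nat y _ _)) assoc_nat !bmap_pre fmap1 !comp1m.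
  by rewrite [in RHS]compA vmap_G0l lwhiskerM !compA triangle.
rewrite (comp_pre3 (cbraid_v_right y _ _ _)) !(compA (_ ⊗ _)) (compA (mid _ _)).
rewrite -rwhiskerM cbraid_unit_right rwhiskerM.
rewrite (comp_pre (mid_nat (G0 G) (f := cbraid y X Z) (g2 := idm _) (h2 := idm _) _)).
  by rewrite !bmap1 comp1m compm1.
rewrite !bmap_pre fmap1 !comp1m [X in X ⊗ _]compA vmap_G0l rwhiskerM !(compA (_ ⊗ _)).
rewrite -(comp_pre (esym (mid_unit _))) -bmapM.
by rewrite (comp_pre1 (lunitVK _)) !comp1m.
Qed.

Lemma cbraid_comul (X Y : C) :
  cbraid y (G X) (G Y) ∘ (comul G X ⊗ comul G Y)
    = (comul G Y ⊗ comul G X) ∘ cbraid y X Y.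
Proof.
rewrite (bmap_lr (comul G X)) (comp_pre (cbraid_comul_left _ _)).
by rewrite cbraid_comul_right bmap_pre comp1m compm1.
Qed.

(* A coalgebra A is a (split) equalizer of comul and fmap (coact A), so a map
   of the ambient free coalgebras compatible with both restricts to A. *)
Lemma coact_descent (A B : Coalgebra G) (t : hom (G A ⊙ G B) (G B ⊙ G A))
    (tG : hom (G (G A) ⊙ G (G B)) (G (G B) ⊙ G (G A))) :
  tG ∘ (fmap G (coact A) ⊗ fmap G (coact B))
    = (fmap G (coact B) ⊗ fmap G (coact A)) ∘ t ->
  tG ∘ (comul G A ⊗ comul G B) = (comul G B ⊗ comul G A) ∘ t ->
  (coact B ⊗ coact A) ∘ (counit G B ⊗ counit G A) ∘ t ∘ (coact A ⊗ coact B)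
    = t ∘ (coact A ⊗ coact B).
Proof.
move=> t_coact t_comul.
rewrite bmap_pre -!counit_nat bmapM !compA -(comp_pre t_coact) -bmapM.
rewrite -!coact_comul bmapM (comp_pre t_comul) bmap_pre !counit_comul.
by rewrite bmap1 comp1m.
Qed.

(** * Descent of y from cofree to arbitrary coalgebras *)

Definition descend (A B : Coalgebra G) : hom (A ⊙ B) (B ⊙ A) :=
  (counit G B ⊗ counit G A) ∘ cbraid y A B ∘ (coact A ⊗ coact B).

(** As coact.coact is a split monomorphism, this square determines [descend]; invertibility,
    compatibility with coactions and the hexagons are deduced from it. *)
Lemma coact_descend (A B : Coalgebra G) :
  (coact B ⊗ coact A) ∘ descend A B = cbraid y A B ∘ (coact A ⊗ coact B).
Proof. by apply: coact_descent; [exact: cbraid_nat | exact: cbraid_comul]. Qed.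

Lemma coact_coact_mono (A B : Coalgebra G) (W : C) (f g : hom W (A ⊙ B)) :
  (coact A ⊗ coact B) ∘ f = (coact A ⊗ coact B) ∘ g -> f = g.
Proof.
move=> /(f_equal (comp (counit G A ⊗ counit G B))).
by rewrite !bmap_pre !coact_counit bmap1 !comp1m.
Qed.

(** This is (iv) at X = I: [assoc_vmap_twice] brings it to an equation between maps G2 (1.h) and G2
    (1.h'). *)
Lemma cbraid_morP (Y Z : C) :
  coact (coalg_tensor_ob (cofree Z) (cofree Y)) ∘ cbraid y Y Z
    = fmap G (cbraid y Y Z) ∘ coact (coalg_tensor_ob (cofree Y) (cofree Z)).
Proof.
set h := LHS; set h' := RHS.
have e : G2 G (munit C) _ ∘ (idm _ ⊗ h) = G2 G (munit C) _ ∘ (idm _ ⊗ h').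
  apply: assoc_epi.
  have := f_equal (comp (fmap G (assoc _ _ _))) (cbraid_v_v y (munit C) Y Z).
  rewrite (comp_pre1 (esym (fmapM _ _ _))) assoc_mid fmapM compA.
  rewrite assoc_vmap_twice (comp_pre3 (assoc_vmap_twice _ _ _)).
  rewrite -(comp_pre (G2_nat _ _ _)) fmap1 bmap_pre comp1m.
  rewrite 2!(compA _ _ (mid _ _)) assoc_mid bmap_pre comp1m.
  move=> ev; rewrite [LHS]compA [RHS]compA.
  exact: (esym ev).
apply: (iso_epi (is_iso_lunit _)).
have := f_equal (fun k => fmap G (lunit _) ∘ k ∘ (G0 G ⊗ idm _)) e.
(* Inserting [G0] and applying the left unit law recovers k from G2 (1.k). *)
have E k : fmap G (lunit (G Z ⊙ G Y)) ∘ (G2 G (munit C) _ ∘ (idm _ ⊗ k))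
    ∘ (G0 G ⊗ idm _) = k ∘ lunit (G Y ⊙ G Z).
  rewrite compA -bmapM comp1m compm1 [G0 G ⊗ k]bmap_lr.
  by rewrite (comp_pre3 (G2_lunit _ _)) lunit_nat.
by rewrite /= !E.
Qed.

(** It suffices to compare after the split monomorphism G(coact.coact). The coactions are coalgebra
    maps, so the claim reduces to [cbraid_morP]. *)
Lemma descend_morP (A B : Coalgebra G) :
  coact (coalg_tensor_ob B A) ∘ descend A B
    = fmap G (descend A B) ∘ coact (coalg_tensor_ob A B).
Proof.
have coactK : fmap G (counit G B ⊗ counit G A) ∘ fmap G (coact B ⊗ coact A)
    = idm _.
  by rewrite -fmapM -bmapM !coact_counit bmap1 fmap1.
rewrite -[LHS]comp1m -[RHS]comp1m -coactK !(compA (fmap G _)).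
have y_mor := cbraid_morP A B.
have a_mor := coalg_morP (coalg_tensor_mor (coact_hom A) (coact_hom B)).
have b_mor := coalg_morP (coalg_tensor_mor (coact_hom B) (coact_hom A)).
move: (descend A B) (coact_descend A B) => c e.
rewrite /= !compA in y_mor a_mor b_mor *.
rewrite (comp_pre3 (esym b_mor)) !compA e (comp_pre3 y_mor) !compA a_mor.
by rewrite !(comp_pre1 (esym (fmapM _ _ _))) !compA e.
Qed.

Lemma descend_nat (A A' B B' : Coalgebra G)
    (f : CoalgHom A A') (g : CoalgHom B B') :
  descend A' B' ∘ (coalg_mor f ⊗ coalg_mor g)
    = (coalg_mor g ⊗ coalg_mor f) ∘ descend A B.
Proof.
rewrite /descend !compA -bmapM !coalg_morP bmapM (comp_pre (cbraid_nat y _ _)).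
by rewrite !bmap_pre !counit_nat.
Qed.

Lemma descend_iso (A B : Coalgebra G) : exists d : hom (B ⊙ A) (A ⊙ B),
  d ∘ descend A B = idm _ /\ descend A B ∘ d = idm _.
Proof.
have [z [zy yz]] := cbraid_iso y A B.
have [zG [zyG yzG]] := cbraid_iso y (G A) (G B).
(* The inverses of y satisfy the inverted squares, so they descend by the same formula. *)
pose d := (counit G A ⊗ counit G B) ∘ z ∘ (coact B ⊗ coact A).
have ed : (coact A ⊗ coact B) ∘ d = z ∘ (coact B ⊗ coact A).
  apply: (coact_descent (tG := zG)).
    exact: (comp_inv_square yz zyG (cbraid_nat y _ _)).
  exact: (comp_inv_square yz zyG (cbraid_comul _ _)).
exists d; split; apply: coact_coact_mono; rewrite compm1.
- by rewrite (comp_pre ed) coact_descend (comp_pre1 zy) comp1m.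
- by rewrite (comp_pre (coact_descend A B)) ed (comp_pre1 yz) comp1m.
Qed.

(** Makes v (coact.coact) a split monomorphism from A.B to G(A.GB). The hexagons are checked after
    it, because (ii) and (iii) evaluate y at objects of the form A.GB. *)
Lemma vmap_coactK (A B : Coalgebra G) :
  (idm A ⊗ counit G B) ∘ counit G _ ∘ vmap G A B ∘ (coact A ⊗ coact B)
    = idm _.
Proof.
by rewrite (comp_pre1 (counit_vmap _ _ _)) -!bmapM !comp1m !coact_counit bmap1.
Qed.

Lemma vmap_coact_bmap_mono_l (A B D : Coalgebra G) (W : C)
    (f g : hom W (A ⊙ B ⊙ D)) :
  ((vmap G A B ∘ (coact A ⊗ coact B)) ⊗ coact D) ∘ f
    = ((vmap G A B ∘ (coact A ⊗ coact B)) ⊗ coact D) ∘ g -> f = g.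
Proof.
move/(f_equal (comp (((idm A ⊗ counit G B) ∘ counit G _) ⊗ counit G D))).
by rewrite !bmap_pre compA vmap_coactK coact_counit bmap1 !comp1m.
Qed.

Lemma vmap_coact_bmap_mono_r (A B D : Coalgebra G) (W : C)
    (f g : hom W (D ⊙ (A ⊙ B))) :
  (coact D ⊗ (vmap G A B ∘ (coact A ⊗ coact B))) ∘ f
    = (coact D ⊗ (vmap G A B ∘ (coact A ⊗ coact B))) ∘ g -> f = g.
Proof.
move/(f_equal (comp (counit G D ⊗ ((idm A ⊗ counit G B) ∘ counit G _)))).
by rewrite !bmap_pre compA vmap_coactK coact_counit bmap1 !comp1m.
Qed.

Lemma descend_right (A B D : Coalgebra G) :
  descend A (coalg_tensor_ob B D) ∘ assoc A B D
    = mid B (descend A D) ∘ (descend A B ⊗ idm D).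
Proof.
apply: vmap_coact_bmap_mono_l.
(* [vmap_coact] and naturality of y along 1.coact replace the coalgebra B.D by the cofree one on
   B.GD, where (ii) applies. *)
transitivity (cbraid y A (B ⊙ G D) ∘ (idm _ ⊗ vmap G B D) ∘ assoc _ _ _
    ∘ (coact A ⊗ coact B ⊗ coact D)).
  have e := coact_descend A (coalg_tensor_ob B D).
  rewrite assoc_nat bmap_pre comp1m -vmap_coact.
  rewrite -[X in X ⊗ (fmap _ _ ∘ _)]comp1m -[X in (fmap _ _ ∘ _) ⊗ X]comp1m.
  rewrite !bmapM compA (comp_pre e) -fmap1 -(comp_pre (cbraid_nat y _ _)).
  by rewrite !compA.
rewrite (comp_pre3 (cbraid_v_right y _ _ _)).
have sq : (cbraid y A B ⊗ idm _) ∘ (coact A ⊗ coact B ⊗ coact D)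
    = (coact B ⊗ coact A ⊗ coact D) ∘ (descend A B ⊗ idm D).
  by rewrite -!bmapM coact_descend comp1m compm1.
rewrite !(compA (_ ⊗ _)) (compA (mid _ _)) sq.
rewrite (comp_pre (mid_nat _ (esym (coact_descend A D)))).
by rewrite bmap_pre comp1m.
Qed.

Lemma descend_left (A B D : Coalgebra G) :
  descend (coalg_tensor_ob A B) D
    = assoc D A B ∘ (descend A D ⊗ idm B) ∘ mid A (descend B D).
Proof.
apply: vmap_coact_bmap_mono_r.
transitivity (cbraid y (A ⊙ G B) D ∘ (vmap G A B ⊗ idm _)
    ∘ (coact A ⊗ coact B ⊗ coact D)).
  have e := coact_descend (coalg_tensor_ob A B) D.
  rewrite -bmapM comp1m -vmap_coact.
  rewrite -[X in X ⊗ (fmap _ _ ∘ _)]comp1m -[X in (fmap _ _ ∘ _) ⊗ X]comp1m.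
  by rewrite !bmapM compA e -fmap1 -(comp_pre (cbraid_nat y _ _)).
rewrite (comp_pre1 (cbraid_v_left y _ _ _)).
have sq : (cbraid y A D ⊗ idm _) ∘ (coact A ⊗ coact D ⊗ coact B)
    = (coact D ⊗ coact A ⊗ coact B) ∘ (descend A D ⊗ idm B).
  by rewrite -!bmapM coact_descend comp1m compm1.
rewrite !(compA (_ ⊗ _)) (compA (assoc _ _ _)) (compA (_ ⊗ _)).
rewrite (mid_nat _ (esym (coact_descend B D))) (comp_pre sq).
by rewrite (comp_pre (assoc_nat _ _ _)) bmap_pre comp1m.
Qed.

Definition descend_hom (A B : Coalgebra G) :
  CoalgHom (coalg_tensor_ob A B) (coalg_tensor_ob B A).
Proof. by exists (descend A B); exact: descend_morP. Defined.

Definition coalg_braiding_of_comonad : Braiding (coalg_monoidal G).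
Proof.
refine (@Build_Braiding (coalg_monoidal G) descend_hom _ _ _ _).
- move=> A A' B B' f g; apply: CoalgHom_ext.
  exact: descend_nat.
- move=> A B; have [d [dc cd]] := descend_iso A B.
  exists (@Build_CoalgHom _ _ (coalg_tensor_ob B A) (coalg_tensor_ob A B) d
    (@coalg_inv_morP _ _ (coalg_tensor_ob A B) (coalg_tensor_ob B A) _ d
      cd dc (descend_morP A B))).
  by split; apply: CoalgHom_ext.
- move=> A B D; apply: CoalgHom_ext => /=.
  by rewrite descend_right (comp_pre (assoc_mid _ _)).
- move=> A B D; apply: CoalgHom_ext => /=.
  rewrite descend_left (compA (assoc _ _ _)) (comp_pre1 (assocK _ _ _)) comp1m.
  by rewrite /mid !compA assocVK compm1.
Defined.

End Forward.

(** * The two passages are mutually inverse *)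

Lemma coalg_braiding_of_comonad_bijective :
  bijective coalg_braiding_of_comonad.
Proof.
exists comonad_braiding_of_coalg.
- move=> y; apply: ComonadBraiding_ext => X Y.
  (* On cofree coalgebras the coactions are [comul]; they pass through y and cancel against the
     counits. *)
  rewrite /= /cofree_braid /= /descend /= cbraid_comul bmap_pre.
  by rewrite !counit_comul bmap1 comp1m.
- move=> c; apply: Braiding_ext => A B; apply: CoalgHom_ext.
  rewrite /= /descend /= /cofree_braid.
  (* Naturality of c along the coactions of A and B moves them to the left of c, where the counits
     cancel them. *)
  rewrite (coalg_braid_nat c (coact_hom A) (coact_hom B)) /= bmap_pre.
  by rewrite !coact_counit bmap1 comp1m.
Qed.

End Coalgebras.

Theorem theorem4p5 (C : MonoidalCategory)
    (munit_jointly_epi : forall X A : C,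
       jointly_epi (fun x : hom (munit C) X => x ⊗ idm A))
    (G : MonoidalComonad C) :
  exists (phi : ComonadBraiding G -> Braiding (coalg_monoidal G))
         (psi : ComonadBraiding G -> SkewBraiding (cowarping G)),
    bijective phi /\ bijective psi.
Proof.
exists (@coalg_braiding_of_comonad C G), (@skew_of_comonad_braiding C G).
split; first exact: coalg_braiding_of_comonad_bijective.
exact: skew_of_comonad_braiding_bijective munit_jointly_epi.
Qed.
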